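(* Let $d\ge2$ and assume that for each $j\in[d]$ the kernel $k^j$ is translation invariant and has non-empty level sets on $\mathbb X^j$. Suppose that $\epsilon>0,\delta\in[0,1)$, hence $\xi_{\epsilon,\delta}$, are fixed as $n\to\infty$, and that the number of resamples $B=B_n$ satisfies $\min_{n\ge1}B_n>\alpha^{-1}-1$. If $\alpha<1/2$, then the DP bootstrap dHSIC test (defined in the context) has inconsistent power against some fixed alternatives: there is a distribution $P\neq\otimes_{j=1}^dP_{X^j}$ on $\mathbb X^1\times\dots\times\mathbb X^d$ with $\limsup_{n\to\infty}\mathbb P_P(\hat p_{\mathrm{dp}}\le\alpha)<1$. Moreover, there is a constant $C_{\epsilon,\delta}>0$ depending only on $\epsilon$ and $\delta$ such that, if $\alpha<C_{\epsilon,\delta}$ (and $\alpha<1/2$), the DP bootstrap dHSIC test has inconsistent power against all alternatives: $\limsup_{n\to\infty}\mathbb P_P(\hat p_{\mathrm{dp}}\le\alpha)<1$ for every $P\ne\otimes_{j=1}^dP_{X^j}$.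
   Context: Superscripts $j\in[d]=\{1,\dots,d\}$ are indices, not exponents. For each $j$, $\mathbb X^j$ is a separable topological space on which differences make sense (e.g. a subset of a Euclidean space) and $k^j:\mathbb X^j\times\mathbb X^j\to\mathbb R$ is a continuous, bounded, positive semi-definite kernel with RKHS $\mathcal H^j$ and $0\le k^j(x,x')\le K^j$. Translation invariant: $k^j(x,x')=\kappa^j(x-x')$ for a symmetric positive definite function $\kappa^j$; the bound is taken to be $K^j=\kappa^j(0)$. Non-empty level sets: for any $\varepsilon\in(0,K^j)$ there exist $x,x'\in\mathbb X^j$ with $k^j(x,x')\le\varepsilon$. The tensor product kernel $\mathbf k((x^j)_j,(x'^j)_j)=\prod_{j}k^j(x^j,x'^j)$, with RKHS $\mathcal H_{\mathbf k}=\mathcal H^1\otimes\dots\otimes\mathcal H^d$ and unit ball $\mathcal F_{\mathbf k}$, is assumed characteristic. $\mathcal X_n=(\mathbf X_1,\dots,\mathbf X_n)$, $\mathbf X_i=(X_i^1,\dots,X_i^d)$, is an i.i.d. sample from $P=P_{X^1,\dots,X^d}$ with marginals $P_{X^j}$; $H_0:P=\otimes_jP_{X^j}$. Empirical dHSIC: $$\widehat{\mathrm{dHSIC}}(\mathcal X_n)=\sup_{f\in\mathcal F_{\mathbf k}}\Big\{\frac1n\sum_{i=1}^nf(X_i^1,\dots,X_i^d)-\frac1{n^d}\sum_{(i_1,\dots,i_d)\in[n]^d}f(X_{i_1}^1,\dots,X_{i_d}^d)\Big\}.$$ A bootstrap resampling is $\mathbf b=(b^1,\dots,b^d)$ with arbitrary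 maps $b^j:[n]\to[n]$; $\mathcal X_n^{\mathbf b}$ has $i$-th element $(X^1_{b^1(i)},\dots,X^d_{b^d(i)})$. Its sensitivity is $\Delta_T^{\mathbf b}=\sup_{\mathbf b}\sup|\widehat{\mathrm{dHSIC}}(\mathcal X_n^{\mathbf b})-\widehat{\mathrm{dHSIC}}(\tilde{\mathcal X}_n^{\mathbf b})|$, over all bootstrap maps and all pairs of datasets of size $n$ differing in at most one $\mathbf X_i$. DP bootstrap dHSIC test at level $\alpha\in(0,1)$: let $\xi_{\epsilon,\delta}=\epsilon+\log(1/(1-\delta))$; $\mathbf b_0$ the identity; $\mathbf b_1,\dots,\mathbf b_B$ i.i.d. random bootstrap maps (uniform over all bootstrap resamplings); $\zeta_0,\dots,\zeta_B$ i.i.d. standard Laplace (location $0$, scale $1$), all independent of each other and of the data. Put $M_i=\widehat{\mathrm{dHSIC}}(\mathcal X_n^{\mathbf b_i})+2\Delta_T^{\mathbf b}\xi_{\epsilon,\delta}^{-1}\zeta_i$ and $\hat p_{\mathrm{dp}}=\frac1{B+1}\{\sum_{i=1}^B\mathbb 1(M_i\ge M_0)+1\}$; reject iff $\hat p_{\mathrm{dp}}\le\alpha$. ''Inconsistent power against $P$'' means $\limsup_{n\to\infty}\mathbb P_P(\hat p_{\mathrm{dp}}\le\alpha)<1$. *)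

(* Defs.v *)
From HB Require Import structures.
From mathcomp Require Import all_boot all_order all_algebra.
From mathcomp Require Import all_classical all_reals all_analysis.

Set Implicit Arguments.
Unset Strict Implicit.
Unset Printing Implicit Defensive.
Import Order.TTheory GRing.Theory Num.Theory.
Import numFieldNormedType.Exports.
Local Open Scope classical_set_scope.
Local Open Scope ring_scope.

Definition separable_space (T : topologicalType) : Prop :=
  exists S : set T, countable S /\ dense S.

Definition psd_kernel (R : realType) (T : Type) (k : T -> T -> R) : Prop :=
  (forall x y, k x y = k y x) /\
  (forall m (x : 'I_m -> T) (c : 'I_m -> R),
     0 <= \sum_(i < m) \sum_(j < m) c i * c j * k (x i) (x j)).

(* "Differences make sense" on T through an injection iota of T into an abelian
   group V.  The first conjunct says that kappa is a symmetric positive definite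
   function, on the differences of points of T (the only place where it is
   evaluated). *)
Definition translation_invariant (R : realType) (T : Type) (V : zmodType)
    (iota : T -> V) (kappa : V -> R) (k : T -> T -> R) : Prop :=
  psd_kernel (fun x x' => kappa (iota x - iota x')) /\
  (forall x x', k x x' = kappa (iota x - iota x')).

Definition nonempty_level_sets (R : realType) (T : Type) (k : T -> T -> R)
    (K : R) : Prop :=
  forall e : R, 0 < e < K -> exists x x', k x x' <= e.

(* The reproducing kernel Hilbert space of k: a Hilbert space of functions on T
   containing the sections of k, with the reproducing property.  The conditions
   on rkhs_dot only concern elements of the space.  By the Moore-Aronszajn
   theorem such a space exists and is unique when k is positive semi-definite. *)
Record rkhs (R : realType) (T : Type) (k : T -> T -> R) := Rkhs {
  rkhs_space : set (T -> R);
  rkhs_dot : (T -> R) -> (T -> R) -> R;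
  rkhs_zero : rkhs_space 0;
  rkhs_lin : forall (a : R) f g,
    rkhs_space f -> rkhs_space g -> rkhs_space (a *: f + g);
  rkhs_dotC : forall f g,
    rkhs_space f -> rkhs_space g -> rkhs_dot f g = rkhs_dot g f;
  rkhs_dot_lin : forall (a : R) f g h,
    rkhs_space f -> rkhs_space g -> rkhs_space h ->
    rkhs_dot (a *: f + g) h = a * rkhs_dot f h + rkhs_dot g h;
  rkhs_dot_ge0 : forall f, rkhs_space f -> 0 <= rkhs_dot f f;
  rkhs_dot_eq0 : forall f, rkhs_space f -> rkhs_dot f f = 0 -> f = 0;
  rkhs_complete : forall u : nat -> (T -> R),
    (forall m, rkhs_space (u m)) ->
    (forall e : R, 0 < e -> exists N, forall m p, (N <= m)%N -> (N <= p)%N ->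
       Num.sqrt (rkhs_dot (u m - u p) (u m - u p)) < e) ->
    exists2 f, rkhs_space f &
      forall e : R, 0 < e -> exists N, forall m, (N <= m)%N ->
        Num.sqrt (rkhs_dot (u m - f) (u m - f)) < e;
  rkhs_section : forall x, rkhs_space (k x);
  rkhs_reproducing : forall f x, rkhs_space f -> rkhs_dot f (k x) = f x }.

Definition rkhs_unit_ball (R : realType) (T : Type) (k : T -> T -> R)
    (H : rkhs k) : set (T -> R) :=
  [set f | rkhs_space H f /\ Num.sqrt (rkhs_dot H f f) <= 1].

Section product_space.
Variables (d : nat) (X : 'I_d -> ptopologicalType).

Definition borel (T : ptopologicalType) : set (set T) := <<s @open T >>.

Definition coordinate_events : set (set (forall j, X j)) :=
  [set C | exists (j : 'I_d) (A : set (X j)),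
     borel A /\ C = [set x | A (x j)]].

(* X^1 x ... x X^d with the product of the Borel sigma-algebras *)
Definition prod_space := g_sigma_algebraType coordinate_events.

Definition rectangle (A : forall j, set (X j)) : set prod_space :=
  [set x | forall j, A j (x j)].

Definition marginal (R : realType) (P : probability prod_space R) (j : 'I_d)
    (A : set (X j)) : \bar R := P [set x | A (x j)].

(* P is the product measure of its marginals, i.e. the measure determined by
   its values on measurable rectangles. *)
Definition is_product_of_marginals (R : realType)
    (P : probability prod_space R) : Prop :=
  forall A : forall j, set (X j), (forall j, borel (A j)) ->
    P (rectangle A) = (\prod_(j < d) marginal P (A j))%E.

Definition tensor_kernel (R : realType) (k : forall j, X j -> X j -> R) :
    prod_space -> prod_space -> R :=
  fun x x' => \prod_(j < d) k j (x j) (x' j).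

Definition mean_embedding (R : realType) (k : prod_space -> prod_space -> R)
    (P : probability prod_space R) : prod_space -> \bar R :=
  fun y => (\int[P]_x (k x y)%:E)%E.

Definition characteristic (R : realType)
    (k : prod_space -> prod_space -> R) : Prop :=
  forall P Q : probability prod_space R,
    mean_embedding k P = mean_embedding k Q ->
    forall A, measurable A -> P A = Q A.

End product_space.

Section dp_bootstrap_test.
Variables (R : realType) (d : nat) (X : 'I_d -> ptopologicalType).
Local Notation space := (prod_space X).
Variables (k : space -> space -> R) (H : rkhs k).

Definition dataset (n : nat) := 'I_n -> space.

Definition dHSIC n (D : dataset n) : R :=
  sup [set r | exists2 f, rkhs_unit_ball H f &
    r = n%:R^-1 * (\sum_(i < n) f (D i))
        - (n ^ d)%:R^-1 *
          (\sum_(i : {ffun 'I_d -> 'I_n}) f (fun j => D (i j) j))].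

Definition bootmap n := {ffun 'I_d -> {ffun 'I_n -> 'I_n}}.

Definition id_bootmap n : bootmap n := [ffun=> [ffun i => i]].

Definition resample n (D : dataset n) (b : bootmap n) : dataset n :=
  fun i j => D (b j i) j.

Definition differ_at_most_once n (D D' : dataset n) : Prop :=
  forall i i', D i <> D' i -> D i' <> D' i' -> i = i'.

Definition sensitivity (n : nat) : R :=
  sup [set r | exists (b : bootmap n) (D D' : dataset n),
    differ_at_most_once D D' /\
    r = `|dHSIC (resample D b) - dHSIC (resample D' b)|].

Definition dp_xi (eps delta : R) : R := eps + ln (1 / (1 - delta)).

(* b_0 is the identity and b_1, ..., b_B are the given maps. *)
Definition extend_boot n B (b : 'I_B -> bootmap n) (i : 'I_B.+1) : bootmap n :=
  if unlift ord0 i is Some l then b l else id_bootmap n.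

Definition dp_stat (eps delta : R) n B (D : dataset n) (b : 'I_B -> bootmap n)
    (zeta : 'I_B.+1 -> R) (i : 'I_B.+1) : R :=
  dHSIC (resample D (extend_boot b i))
  + 2 * sensitivity n * (dp_xi eps delta)^-1 * zeta i.

Definition dp_pvalue (eps delta : R) n B (D : dataset n)
    (b : 'I_B -> bootmap n) (zeta : 'I_B.+1 -> R) : R :=
  let M := dp_stat eps delta D b zeta in
  B.+1%:R^-1 * (\sum_(l < B) (M ord0 <= M (lift ord0 l))%R%:R + 1).

End dp_bootstrap_test.

Definition independent_systems (R : realType) (dO : measure_display)
    (Omega : measurableType dO) (Pr : probability Omega R) (I : finType)
    (F : I -> set (set Omega)) : Prop :=
  forall (J : {set I}) (A : I -> set Omega), (forall i, i \in J -> F i (A i)) ->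
    Pr (\bigcap_(i in [set` J]) A i) = (\prod_(i in J) Pr (A i))%E.

Definition laplace_pdf (R : realType) (x : R) : R := expR (- `|x|) / 2.

(* A probability space carrying all the randomness of the test at sample size n
   with B resamples. *)
Record dp_bootstrap_model (R : realType) (d : nat) (X : 'I_d -> ptopologicalType)
    (P : probability (prod_space X) R) (n B : nat) := DPBootstrapModel {
  model_display : measure_display;
  model_space : measurableType model_display;
  model_prob : probability model_space R;
  model_data : 'I_n -> model_space -> prod_space X;
  model_boot : 'I_B -> model_space -> bootmap d n;
  model_noise : 'I_B.+1 -> model_space -> R;
  model_data_measurable : forall i, measurable_fun setT (model_data i);
  model_boot_measurable : forall l b, measurable (model_boot l @^-1` [set b]);
  model_noise_measurable : forall i, measurable_fun setT (model_noise i);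
  model_data_law : forall i A, measurable A ->
    model_prob (model_data i @^-1` A) = P A;
  model_boot_law : forall l b,
    model_prob (model_boot l @^-1` [set b]) = (#|bootmap d n|%:R^-1)%:E;
  model_noise_law : forall i A, measurable A ->
    model_prob (model_noise i @^-1` A) =
    (\int[lebesgue_measure]_(x in A) (laplace_pdf x)%:E)%E;
  model_independent : independent_systems model_prob
    (fun v : 'I_n + ('I_B + 'I_B.+1) => match v with
     | inl i => preimage_set_system setT (model_data i) measurable
     | inr (inl l) => preimage_set_system setT (model_boot l) setT
     | inr (inr i) => preimage_set_system setT (model_noise i) measurable
     end) }.

Arguments model_space {R d X P n B} _.
Arguments model_prob {R d X P n B} _.
Arguments model_data {R d X P n B} _.
Arguments model_boot {R d X P n B} _.
Arguments model_noise {R d X P n B} _.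

Definition rejection_probability (R : realType) (d : nat)
    (X : 'I_d -> ptopologicalType) (k : prod_space X -> prod_space X -> R)
    (H : rkhs k) (eps delta alpha : R) (P : probability (prod_space X) R)
    (n B : nat) (W : dp_bootstrap_model P n B) : \bar R :=
  model_prob W [set w |
    dp_pvalue H eps delta (fun i => model_data W i w)
      (fun l => model_boot W l w) (fun i => model_noise W i w) <= alpha].

(* The rejection probability only depends on P and n, not on the model. *)
Definition inconsistent_power (R : realType) (d : nat)
    (X : 'I_d -> ptopologicalType) (k : prod_space X -> prod_space X -> R)
    (H : rkhs k) (eps delta alpha : R) (B : nat -> nat)
    (P : probability (prod_space X) R) : Prop :=
  forall W : forall n, dp_bootstrap_model P n (B n),
    (limn_esup (fun n => rejection_probability H eps delta alpha (W n)) < 1)%E.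

(* Main.v *)
Require Import Defs.
From HB Require Import structures.
From mathcomp Require Import all_boot all_order all_algebra.
From mathcomp Require Import all_classical all_reals all_analysis.
From mathcomp Require Import measurable_realfun exponential_distribution.
From mathcomp Require Import ring lra.
Set Implicit Arguments.
Unset Strict Implicit.
Unset Printing Implicit Defensive.
Import Order.TTheory GRing.Theory Num.Theory.
Import numFieldNormedType.Exports.
Local Open Scope classical_set_scope.
Local Open Scope ring_scope.

(** The reason for the inconsistency is that the bootstrap maps are arbitrary,
    so that a single observation can be copied to half of the positions. The
    sensitivity of dHSIC therefore does not vanish as n grows: replacing one
    point x of a constant dataset by a point y far from x in two coordinates,
    then copying y to half of the positions, moves dHSIC from 0 to a value at
    least (2/9) kappa, where kappa is the square root of the product of the
    kernel bounds ([sensitivity_ge]). Since dHSIC always lies between 0 and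
    2 kappa ([tensor_dHSIC_le]), the Laplace noise, of scale proportional to
    the sensitivity, is of the same order as the largest value of the
    statistic, whatever the law of the data.

    Quantitatively, if the noise of the observed statistic is at most
    - (9/2) xi, then every resample with nonnegative noise beats the observed
    statistic ([noise_hides_observed_stat]). On that event, rejection requires
    at least (1 - alpha) (B + 1) of the B other noises to be negative, whereas
    each is negative with probability 1/2. By Markov's inequality and pairwise
    independence the conditional probability of rejection is at most
    1 / (2 (1 - alpha)), which is below 1 for alpha < 1/2
    ([rejection_probability_le]). The event has a positive probability that
    depends neither on n nor on B, so the limsup of the power is below 1 for
    every law, and it remains to exhibit one with dependent coordinates: a fair
    choice between two points ([exists_dependent_law]).

    Two tools support the argument. The supremum defining dHSIC is the norm of a
    finite combination of kernel sections ([sup_unit_ball_comb], [dHSICE]), which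
    makes dHSIC explicit on two-point datasets. The rejection event must be
    shown to be measurable ([measurable_rejection]), which rests on the
    measurability of a continuous kernel on a separable space
    ([measurable_kernel]). *)

(** * Suprema of linear functionals over the unit ball of an RKHS *)

Lemma sqr_le_of_quadratic_ge0 (R : realType) (a b c : R) : 0 <= a ->
  (forall u, 0 <= u ^+ 2 * a + 2 * u * b + c) -> b ^+ 2 <= a * c.
Proof.
move=> a_ge0 q_ge0; have [a0|a_neq0] := eqVneq a 0.
  suff -> : b = 0 by rewrite a0 expr0n mul0r.
  apply/eqP; apply: contraT => b_neq0.
  have := q_ge0 (- (c + 1) / (2 * b)); rewrite a0 mulr0 add0r.
  have -> : 2 * (- (c + 1) / (2 * b)) * b = - (c + 1) by field.
  by lra.
have := q_ge0 (- b / a).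
have -> : (- b / a) ^+ 2 * a + 2 * (- b / a) * b + c = (a * c - b ^+ 2) / a.
  by field.
by rewrite pmulr_lge0 ?invr_gt0 ?lt_def ?a_neq0// subr_ge0.
Qed.

Section rkhs_theory.
Context {R : realType} {T : Type} {k : T -> T -> R} (H : rkhs k).
Local Notation dot := (rkhs_dot H).
Local Notation space := (rkhs_space H).

Lemma rkhs_cauchy_schwarz f g : space f -> space g ->
  dot f g ^+ 2 <= dot f f * dot g g.
Proof.
move=> Hf Hg; apply: sqr_le_of_quadratic_ge0; first exact: rkhs_dot_ge0.
move=> u; have Hufg := rkhs_lin u Hf Hg.
have := rkhs_dot_ge0 Hufg.
rewrite rkhs_dot_lin// (rkhs_dotC Hf Hufg) (rkhs_dotC Hg Hufg).
by rewrite !rkhs_dot_lin// (rkhs_dotC Hg Hf); congr (0 <= _); ring.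
Qed.

Lemma rkhs_dot0l g : space g -> dot 0 g = 0.
Proof.
move=> Hg; have := rkhs_dot_lin (-1) (rkhs_zero H) (rkhs_zero H) Hg.
by rewrite scaler0 addr0 => ->; rewrite mulN1r addNr.
Qed.

Lemma rkhs_dotZl a f g : space f -> space g -> dot (a *: f) g = a * dot f g.
Proof.
move=> Hf Hg; rewrite -[_ *: f]addr0 rkhs_dot_lin ?rkhs_dot0l ?addr0//.
exact: rkhs_zero.
Qed.

Lemma rkhs_dot_comb (I : Type) (s : seq I) (c : I -> R) (p : I -> T) :
  space (\sum_(i <- s) c i *: k (p i)) /\
  forall g, space g ->
    dot (\sum_(i <- s) c i *: k (p i)) g = \sum_(i <- s) c i * g (p i).
Proof.
elim: s => [|i s [IHs IHd]].
  rewrite big_nil; split; first exact: rkhs_zero.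
  move=> g Hg; rewrite big_nil.
  exact: rkhs_dot0l.
rewrite big_cons; split; first exact: rkhs_lin (rkhs_section _ _) _.
move=> g Hg; rewrite big_cons rkhs_dot_lin ?IHd//; last exact: rkhs_section.
by rewrite (rkhs_dotC (rkhs_section H _) Hg) rkhs_reproducing.
Qed.

(** The functional is the inner product with its Riesz representer, so by
    Cauchy-Schwarz its supremum over the unit ball is the norm of the
    representer, reached at the normalized representer. *)
Lemma sup_unit_ball_comb (I : finType) (c : I -> R) (p : I -> T) :
  sup [set r | exists2 f, rkhs_unit_ball H f & r = \sum_i c i * f (p i)] =
  Num.sqrt (\sum_i c i * \sum_j c j * k (p j) (p i)).
Proof.
have [Hm dotm] := rkhs_dot_comb (index_enum I) c p.
set m := \sum_i _ in Hm dotm.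
have -> : \sum_i c i * \sum_j c j * k (p j) (p i) = dot m m.
  rewrite dotm//; apply: eq_bigr => i _; congr (_ * _).
  by rewrite /m fct_sumE.
set F := [set r | _].
have F_ub : ubound F (Num.sqrt (dot m m)).
  move=> _ [f [Hf f_le1] ->]; rewrite -dotm//.
  apply: le_trans (ler_norm _) _; rewrite -sqrtr_sqr ler_sqrt ?rkhs_dot_ge0//.
  rewrite (rkhs_dotC Hm Hf); apply: le_trans (rkhs_cauchy_schwarz Hf Hm) _.
  apply: ler_piMl; first exact: rkhs_dot_ge0.
  by move: f_le1; rewrite -[X in _ <= X]sqrtr1 ler_sqrt.
set s := Num.sqrt _ in F_ub *.
have s2 : dot m m = s ^+ 2 by rewrite sqr_sqrtr// rkhs_dot_ge0.
suff Fs : F s.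
  apply/eqP; rewrite eq_le sup_le_ub//=; last by exists s.
  by apply: ub_le_sup => //; exists s.
have Hsm : space (s^-1 *: m).
  by rewrite -[_ *: m]addr0; apply: rkhs_lin => //; exact: rkhs_zero.
exists (s^-1 *: m).
  split => //; rewrite rkhs_dotZl// rkhs_dotC// rkhs_dotZl// s2.
  have [->|s0] := eqVneq s 0; first by rewrite expr0n !mulr0 sqrtr0.
  by rewrite expr2 mulKf// mulVf// sqrtr1.
rewrite -dotm// rkhs_dotC// rkhs_dotZl// s2.
have [->|s0] := eqVneq s 0; first by rewrite expr0n mulr0.
by rewrite expr2 mulKf.
Qed.

End rkhs_theory.

(** * Closed form of dHSIC *)

Section dHSIC_closed_form.
Context {R : realType} {d : nat} {X : 'I_d -> ptopologicalType}.
Local Notation space := (prod_space X).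

(** The difference of the integrals of f for the empirical measure and for the
    product of its marginals. *)
Definition dHSIC_gap n (D : dataset X n) (f : space -> R) : R :=
  n%:R^-1 * (\sum_(i < n) f (D i))
  - (n ^ d)%:R^-1 * (\sum_(i : {ffun 'I_d -> 'I_n}) f (fun j => D (i j) j)).

Lemma dHSIC_gapZ n (D : dataset X n) c f :
  dHSIC_gap D (fun z => c * f z) = c * dHSIC_gap D f.
Proof. by rewrite /dHSIC_gap -!mulr_sumr mulrBr !(mulrCA c). Qed.

(** dHSIC is the norm of the difference of two mean embeddings; the two nested
    gaps expand its square by bilinearity. *)
Lemma dHSICE (k : space -> space -> R) (H : rkhs k) n (D : dataset X n) :
  dHSIC H D =
  Num.sqrt (dHSIC_gap D (fun z => dHSIC_gap D (fun z' => k z' z))).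
Proof.
pose c (u : 'I_n + {ffun 'I_d -> 'I_n}) : R :=
  if u is inl _ then n%:R^-1 else - (n ^ d)%:R^-1.
pose p (u : 'I_n + {ffun 'I_d -> 'I_n}) : space :=
  match u with inl i => D i | inr i => fun j => D (i j) j end.
have gapE f : dHSIC_gap D f = \sum_u c u * f (p u).
  by rewrite big_sumType/= -!mulr_sumr mulNr.
have -> : dHSIC H D =
    sup [set r | exists2 f, rkhs_unit_ball H f & r = \sum_u c u * f (p u)].
  by congr sup; apply/seteqP; split=> r [f Hf ->]; exists f; rewrite // -gapE.
rewrite sup_unit_ball_comb gapE; congr Num.sqrt.
by apply: eq_bigr => u _; rewrite gapE.
Qed.

Lemma normr_dHSIC_gap_le n (D : dataset X n) f M : (0 < n)%N ->
  (forall z, `|f z| <= M) -> `|dHSIC_gap D f| <= 2 * M.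
Proof.
move=> n_gt0 f_le.
have mean_le (I : finType) (g : I -> R) : (0 < #|I|)%N ->
    (forall i, `|g i| <= M) -> `|#|I|%:R^-1 * \sum_i g i| <= M.
  move=> I_gt0 g_le; rewrite normrM gtr0_norm ?invr_gt0 ?ltr0n//.
  rewrite mulrC ler_pdivrMr ?ltr0n//.
  apply: le_trans (ler_norm_sum _ _ _) _.
  apply: le_trans (ler_sum _ (fun i _ => g_le i)) _.
  by rewrite sumr_const mulr_natr.
rewrite /dHSIC_gap mulr2n mulrDl mul1r.
apply: le_trans (ler_normB _ _) _; apply: lerD.
  by have := mean_le 'I_n (fun i => f (D i)); rewrite card_ord; exact.
have := mean_le {ffun 'I_d -> 'I_n} (fun i => f (fun j => D (i j) j)).
by rewrite card_ffun !card_ord expn_gt0 n_gt0; exact.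
Qed.

Lemma dHSIC_ge0 (k : space -> space -> R) (H : rkhs k) n (D : dataset X n) :
  0 <= dHSIC H D.
Proof. by rewrite dHSICE sqrtr_ge0. Qed.

Lemma dHSIC_le (k : space -> space -> R) (H : rkhs k) n (D : dataset X n) M :
  (0 < n)%N -> 0 <= M -> (forall z z', `|k z z'| <= M) ->
  dHSIC H D <= 2 * Num.sqrt M.
Proof.
move=> n_gt0 M_ge0 k_le; rewrite dHSICE.
have -> : 2 * Num.sqrt M = Num.sqrt (2 * (2 * M)) :> R.
  have -> : 2 * (2 * M) = 2 ^+ 2 * M by ring.
  by rewrite sqrtrM ?sqr_ge0// sqrtr_sqr ger0_norm.
rewrite ler_sqrt; last by rewrite !mulr_ge0.
apply: le_trans (ler_norm _) _.
by do 2!(apply: normr_dHSIC_gap_le => // ?).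
Qed.

Lemma dHSIC_cst (k : space -> space -> R) (H : rkhs k) n (x : space) :
  (0 < n)%N -> dHSIC H (fun _ : 'I_n => x) = 0.
Proof.
move=> n_gt0; have gap0 f : dHSIC_gap (fun _ : 'I_n => x) f = 0.
  have mean_cst N (a : R) : (0 < N)%N -> N%:R^-1 * (a *+ N) = a.
    by move=> N_gt0; rewrite -[a *+ N]mulr_natl mulKf// pnatr_eq0 -lt0n.
  rewrite /dHSIC_gap [in X in X - _]sumr_const [in X in _ - X]sumr_const.
  rewrite card_ffun !card_ord !mean_cst ?subrr//.
  by rewrite expn_gt0 n_gt0.
by rewrite dHSICE gap0 sqrtr0.
Qed.

(** Expanding a product of sums, the sum over all tuples of indices factorizes. *)
Lemma dHSIC_gap_prod n (D : dataset X n) (f : forall j, X j -> R) :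
  dHSIC_gap D (fun z => \prod_(j < d) f j (z j)) =
  n%:R^-1 * (\sum_(i < n) \prod_(j < d) f j (D i j))
  - \prod_(j < d) (n%:R^-1 * \sum_(i < n) f j (D i j)).
Proof.
rewrite /dHSIC_gap; congr (_ - _); rewrite big_split/= bigA_distr_bigA/=.
by rewrite prodr_const card_ord natrX exprVn.
Qed.

End dHSIC_closed_form.

Definition two_point_dataset d (X : 'I_d -> ptopologicalType) n m
  (x y : prod_space X) : dataset X n := fun i => if (i < m)%N then y else x.

Lemma sum_two_values (R : nzRingType) n m (a b : R) : (m <= n)%N ->
  \sum_(i < n) (if (i < m)%N then a else b) = m%:R * a + (n - m)%:R * b.
Proof.
move=> m_le; rewrite -(big_mkord xpredT (fun i => if (i < m)%N then a else b)).
rewrite (big_cat_nat (leq0n m) m_le)//=; congr (_ + _).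
  rewrite big_nat (eq_bigr (fun=> a)) => [|i /andP[_ ->]//].
  by rewrite -big_nat sumr_const_nat subn0 mulr_natl.
rewrite big_nat (eq_bigr (fun=> b)) => [|i /andP[]]; last first.
  by rewrite leqNgt => /negPf ->.
by rewrite -big_nat sumr_const_nat mulr_natl.
Qed.

Section two_point_dHSIC.
Context {R : realType} {e : nat} {X : 'I_e.+2 -> ptopologicalType}.
Local Notation space := (prod_space X).
Variables (n m : nat) (x y : space).
Hypotheses (n_gt0 : (0 < n)%N) (m_le : (m <= n)%N)
  (xyE : forall j : 'I_e.+2, (2 <= j)%N -> y j = x j).
Let D := two_point_dataset (n := n) m x y.
Let p : R := m%:R / n%:R.
Let i0 : 'I_e.+2 := ord0.
Let i1 : 'I_e.+2 := lift ord0 ord0.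
Let i2 (j : 'I_e) : 'I_e.+2 := lift ord0 (lift ord0 j).

Let mean_two_values a b :
  n%:R^-1 * (\sum_(i < n) if (i < m)%N then a else b) = p * a + (1 - p) * b.
Proof.
rewrite sum_two_values// natrB// /p; field.
by rewrite pnatr_eq0 -lt0n.
Qed.

(** For a product function, the gap of a two-point dataset is the covariance
    of the first two factors under a two-valued law; the other factors are
    constant and come out. *)
Lemma two_point_gap (f : forall j, X j -> R) :
  dHSIC_gap D (fun z => \prod_j f j (z j)) =
  p * (1 - p) * (f i0 (y i0) - f i0 (x i0)) * (f i1 (y i1) - f i1 (x i1))
  * \prod_(j < e) f (i2 j) (x (i2 j)).
Proof.
have ifD j : \sum_(i < n) f j (D i j) =
    \sum_(i < n) if (i < m)%N then f j (y j) else f j (x j).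
  by apply: eq_bigr => i _; rewrite /D /two_point_dataset; case: ifP.
have ifP : \sum_(i < n) \prod_j f j (D i j) =
    \sum_(i < n) if (i < m)%N then \prod_j f j (y j) else \prod_j f j (x j).
  by apply: eq_bigr => i _; rewrite /D /two_point_dataset; case: ifP.
rewrite dHSIC_gap_prod ifP mean_two_values.
under [X in _ - X]eq_bigr do rewrite ifD mean_two_values.
rewrite !big_ord_recl/= -/i0 -/i1.
rewrite (eq_bigr (fun j => f (i2 j) (x (i2 j)))) => [|j _]; last first.
  by rewrite xyE.
rewrite [X in _ - _ * (_ * X)](eq_bigr (fun j => f (i2 j) (x (i2 j)))); last first.
  by move=> j _; rewrite xyE// -mulrDl addrCA subrr addr0 mul1r.
set C := \prod_(j < e) _; ring.
Qed.

(** The centred embedding of the two-point dataset is p (1 - p) times the tensor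
    product of the differences of the features of y and x in the first two
    coordinates, and of the common feature in the others; its squared norm is
    the product below. *)
Lemma two_point_dHSIC (k : forall j, X j -> X j -> R)
    (H : rkhs (tensor_kernel k)) :
  (forall j t u, k j t u = k j u t) ->
  let dist2 j := k j (y j) (y j) + k j (x j) (x j) - 2 * k j (x j) (y j) in
  dHSIC H D = Num.sqrt ((p * (1 - p)) ^+ 2 * dist2 i0 * dist2 i1 *
    \prod_(j < e) k (i2 j) (x (i2 j)) (x (i2 j))).
Proof.
move=> k_sym dist2.
(* The gap of the kernel section at z is again, up to p (1 - p), a product
   function of z, so that the outer gap is computed by the same formula. *)
pose h (j : 'I_e.+2) (t : X j) :=
  if (j < 2)%N then k j (y j) t - k j (x j) t else k j (x j) t.
rewrite dHSICE; congr Num.sqrt.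
under [X in dHSIC_gap _ X]eq_fun => z.
  rewrite /tensor_kernel (two_point_gap (fun j t => k j t (z j))).
  have -> : p * (1 - p) * (k i0 (y i0) (z i0) - k i0 (x i0) (z i0))
      * (k i1 (y i1) (z i1) - k i1 (x i1) (z i1))
      * \prod_(j < e) k (i2 j) (x (i2 j)) (z (i2 j)) =
    p * (1 - p) * \prod_j h j (z j).
    by rewrite !big_ord_recl/= -!mulrA.
  over.
rewrite dHSIC_gapZ two_point_gap /h/=.
rewrite /dist2 (k_sym i0 (y i0) (x i0)) (k_sym i1 (y i1) (x i1)).
set C := \prod_(j < e) _; ring.
Qed.

End two_point_dHSIC.

(** * Measurability of a continuous kernel *)

Section psd_kernel_metric.
Context {R : realType} {T : Type} {k : T -> T -> R} {K : R}.
Hypotheses (k_psd : psd_kernel k) (k_diag : forall x, k x x = K).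

Lemma psd_kernel3 a b c x y z :
  0 <= (a ^+ 2 + b ^+ 2 + c ^+ 2) * K
       + 2 * a * b * k x y + 2 * b * c * k y z + 2 * a * c * k x z.
Proof.
have [k_sym k_ge0] := k_psd.
have := k_ge0 3 (fun i => nth x [:: x; y; z] i) (fun i => nth 0 [:: a; b; c] i).
rewrite !big_ord_recl !big_ord0/= !k_diag (k_sym y x) (k_sym z x) (k_sym z y).
by congr (0 <= _); ring.
Qed.

(** The distance between the feature vectors of two points. *)
Definition kernel_dist x y : R := Num.sqrt (2 * K - 2 * k x y).

Lemma kernel_distxx x : kernel_dist x x = 0.
Proof. by rewrite /kernel_dist k_diag subrr sqrtr0. Qed.

Lemma kernel_distC x y : kernel_dist x y = kernel_dist y x.
Proof. by rewrite /kernel_dist k_psd.1. Qed.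

Lemma sqr_kernel_dist x y : kernel_dist x y ^+ 2 = 2 * K - 2 * k x y.
Proof.
by rewrite sqr_sqrtr//; have := psd_kernel3 1 (-1) 0 x y y; lra.
Qed.

(** Minkowski's inequality in the feature space: the Cauchy-Schwarz inequality
    needed here is the discriminant condition for the form [psd_kernel3]. *)
Lemma kernel_dist_triangle s x y :
  kernel_dist x y <= kernel_dist x s + kernel_dist s y.
Proof.
have d_ge0 u v : 0 <= kernel_dist u v by exact: sqrtr_ge0.
rewrite -(@ler_pXn2r _ 2)// ?nnegrE ?addr_ge0//.
set a := kernel_dist x s; set c := kernel_dist s y.
have a2 : a ^+ 2 = 2 * K - 2 * k x s by exact: sqr_kernel_dist.
have c2 : c ^+ 2 = 2 * K - 2 * k s y by exact: sqr_kernel_dist.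
(* The inner product of the feature differences (x - s) and (s - y). *)
pose b := k x s - k x y - K + k s y.
have : b ^+ 2 <= a ^+ 2 * c ^+ 2.
  apply: sqr_le_of_quadratic_ge0; first exact: sqr_ge0.
  move=> u; rewrite a2 c2; have := psd_kernel3 u (1 - u) (-1) x s y.
  by congr (0 <= _); rewrite /b; ring.
rewrite -exprMn => b_le.
have : b <= a * c.
  apply: le_trans (ler_norm _) _.
  by rewrite -(@ler_pXn2r _ 2) ?nnegrE ?mulr_ge0 ?d_ge0// real_normK ?num_real.
by rewrite sqrrD a2 c2 sqr_kernel_dist /b; lra.
Qed.

End psd_kernel_metric.

Lemma dense_sequence (T : ptopologicalType) : separable_space T ->
  exists s : nat -> T, forall O : set T, open O -> O !=set0 -> exists n, O (s n).
Proof.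
move=> [S [S_count S_dense]].
have [S0|[s]] := pfcard_geP S_count.
  have [x []] := S_dense setT (ex_intro _ point I) openT.
  by rewrite S0.
exists s => O oO O0; have [x [Ox Sx]] := S_dense O O0 oO.
have [n _ snx] := 'surj_s Sx.
by exists n; rewrite snx.
Qed.

Section kernel_measurability.
Context {R : realType} {T : ptopologicalType} {k : T -> T -> R} {K : R}.
Hypotheses (T_sep : separable_space T) (k_psd : psd_kernel k)
  (k_diag : forall x, k x x = K)
  (k_cont : continuous (fun p : T * T => k p.1 p.2)).
Local Notation dist := (kernel_dist (k := k) (K := K)).

Lemma kernel_section_continuous x : continuous (k x).
Proof.
move=> y; apply: (@continuous_comp _ _ _ (fun z => (x, z))
  (fun p : T * T => k p.1 p.2)); last exact: k_cont.
by apply: cvg_pair => /=; [exact: cvg_cst | exact: cvg_id].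
Qed.

Lemma kernel_dist_continuous x : continuous (dist x).
Proof.
move=> y; apply: continuous_comp; last exact: sqrt_continuous.
apply: continuousB; first exact: cst_continuous.
by apply: continuousM; [exact: cst_continuous | exact: kernel_section_continuous].
Qed.

(** A dense sequence is dense for the kernel metric, the kernel being continuous;
    the triangle inequality is then attained in the limit s n -> x. *)
Lemma kernel_dist_inf : exists s : nat -> T, forall x y,
  dist x y = infs (fun n => dist x (s n) + dist (s n) y) 0.
Proof.
have [s s_dense] := dense_sequence T_sep; exists s => x y.
set u := fun n => _; have u_lb : lbound (range u) (dist x y).
  by move=> _ [n _ <-]; exact: kernel_dist_triangle.
have -> : infs u 0%N = inf (range u).
  by rewrite /infs /sdrop/=; congr inf; apply/seteqP; split=> r [n _ <-]; exists n.
apply/eqP; rewrite eq_le lb_le_inf//=; last by exists (u 0%N), 0%N.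
apply/ler_addgt0Pr => e e_gt0.
have [||n sn_near] := s_dense [set z | dist x z < e / 2].
- have -> : [set z | dist x z < e / 2] = dist x @^-1` `]-oo, e / 2[.
    by apply/seteqP; split=> z; rewrite /= in_itv.
  by apply: open_comp => // z _; exact: kernel_dist_continuous.
- by exists x; rewrite /= kernel_distxx// divr_gt0.
have : inf (range u) <= u n by apply: ge_inf; [exists (dist x y) | exists n].
move/le_trans; apply; rewrite /u.
have := kernel_dist_triangle k_psd k_diag x (s n) y.
by rewrite (kernel_distC k_psd (s n) x) /=; move: sn_near => /=; lra.
Qed.

(** A continuous kernel is measurable for the Borel sigma-algebra of T x T, which
    can be larger than the product of the Borel sigma-algebras. Separability for
    the kernel metric expresses the kernel as a countable infimum of functions
    of a single variable. *)
Lemma measurable_kernel d (Omega : measurableType d) (f g : Omega -> T) :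
  (forall O, open O -> measurable (f @^-1` O)) ->
  (forall O, open O -> measurable (g @^-1` O)) ->
  measurable_fun setT (fun w => k (f w) (g w)).
Proof.
move=> f_meas g_meas.
have meas_comp (h : Omega -> T) (phi : T -> R) : continuous phi ->
    (forall O, open O -> measurable (h @^-1` O)) ->
    measurable_fun setT (phi \o h).
  move=> phi_cont h_meas.
  apply: (measurability _ (RGenOInfty.measurableE R)) => //.
  move=> _ [_ [r ->] <-]; rewrite setTI comp_preimage; apply: h_meas.
  by apply: open_comp => // z _; exact: phi_cont.
have [s dist_inf] := kernel_dist_inf.
have -> : (fun w => k (f w) (g w)) = fun w =>
    K - 2^-1 * (infs (fun n => dist (f w) (s n) + dist (s n) (g w)) 0 : R) ^+ 2.
  apply/funext => w; rewrite -dist_inf sqr_kernel_dist//; field => //.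
apply: measurable_funB => //; apply: measurable_funM => //.
apply: measurable_funX.
apply: (measurable_fun_infs (h := fun n w => dist (f w) (s n) + dist (s n) (g w))).
  move=> w _; exists 0 => _ [n _ <-].
  by rewrite addr_ge0// sqrtr_ge0.
move=> n; apply: measurable_funD.
  under eq_fun do rewrite kernel_distC//.
  by apply: (meas_comp f (dist (s n))) => //; exact: kernel_dist_continuous.
by apply: (meas_comp g (dist (s n))) => //; exact: kernel_dist_continuous.
Qed.

End kernel_measurability.

(** * Measurability of the test *)

Section test_measurability.
Context {R : realType} {d : nat} {X : 'I_d -> ptopologicalType}.
Local Notation space := (prod_space X).

(** Stated on coordinates, because a resampled point takes its coordinates from
    different observations. *)
Definition measurable_coordinates dO (Omega : measurableType dO)
  (f : Omega -> space) : Prop :=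
  forall j (O : set (X j)), open O -> measurable [set w | O (f w j)].

Lemma measurable_fun_coordinates dO (Omega : measurableType dO)
  (f : Omega -> space) : measurable_fun setT f -> measurable_coordinates f.
Proof.
move=> f_meas j O oO; rewrite -[X in measurable X]setTI.
apply: (f_meas measurableT [set x : space | O (x j)]).
apply: sub_sigma_algebra; exists j, O; split => //.
exact: sub_sigma_algebra.
Qed.

Variables (k : forall j, X j -> X j -> R) (K : 'I_d -> R).
Hypotheses (X_sep : forall j, separable_space (X j))
  (k_psd : forall j, psd_kernel (@k j)) (k_diag : forall j (x : X j), k x x = K j)
  (k_cont : forall j, continuous (fun p : X j * X j => k p.1 p.2)).
Variable H : rkhs (tensor_kernel k).

Lemma measurable_tensor_kernel dO (Omega : measurableType dO)
    (f g : Omega -> space) :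
  measurable_coordinates f -> measurable_coordinates g ->
  measurable_fun setT (fun w => tensor_kernel k (f w) (g w)).
Proof.
move=> f_meas g_meas; apply: measurable_prod => j _.
apply: (measurable_kernel (X_sep j) (k_psd j) (@k_diag j) (@k_cont j)
  (f := fun w => f w j) (g := fun w => g w j)).
  by move=> O oO; exact: f_meas.
by move=> O oO; exact: g_meas.
Qed.

Lemma measurable_dHSIC_gap dO (Omega : measurableType dO) n
    (D : Omega -> dataset X n) (F : Omega -> space -> R) :
  (forall i, measurable_coordinates (fun w => D w i)) ->
  (forall q, measurable_coordinates q -> measurable_fun setT (fun w => F w (q w))) ->
  measurable_fun setT (fun w => dHSIC_gap (D w) (F w)).
Proof.
move=> D_meas F_meas.
apply: measurable_funB; apply: measurable_funM => //; apply: measurable_sum => i.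
  exact: F_meas.
by apply: F_meas => j O oO; exact: (D_meas (i j)).
Qed.

Lemma measurable_dHSIC dO (Omega : measurableType dO) n
    (D : Omega -> dataset X n) :
  (forall i, measurable_coordinates (fun w => D w i)) ->
  measurable_fun setT (fun w => dHSIC H (D w)).
Proof.
move=> D_meas; under eq_fun do rewrite dHSICE.
apply: measurableT_comp.
  by apply: continuous_measurable_fun => r; exact: sqrt_continuous.
apply: measurable_dHSIC_gap => // q q_meas.
apply: (measurable_dHSIC_gap (F := fun w z' => tensor_kernel k z' (q w))) => //.
by move=> q' q'_meas; exact: measurable_tensor_kernel.
Qed.

Lemma measurable_finite_choice dO (Omega : measurableType dO) (I : finType)
    (Y : Omega -> I) (F : I -> Omega -> R) :
  (forall b, measurable (Y @^-1` [set b])) ->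
  (forall b, measurable_fun setT (F b)) ->
  measurable_fun setT (fun w => F (Y w) w).
Proof.
move=> Y_meas F_meas.
have -> : (fun w => F (Y w) w) =
    fun w => \sum_b \1_(Y @^-1` [set b]) w * F b w.
  apply/funext => w; rewrite (bigD1 (Y w))//= indicE mem_set// mul1r.
  rewrite big1 ?addr0// => b /eqP b_neq; rewrite indicE memNset ?mul0r//=.
  by move=> /esym.
by apply: measurable_sum => b; apply: measurable_funM.
Qed.

Variables (P : probability space R) (n B : nat) (W : dp_bootstrap_model P n B).
Variables (eps delta : R).

Lemma measurable_dp_stat i :
  measurable_fun setT (fun w => dp_stat H eps delta (fun i => model_data W i w)
    (fun l => model_boot W l w) (fun i => model_noise W i w) i).
Proof.
have resample_meas b : measurable_fun setT
    (fun w => dHSIC H (resample (fun i => model_data W i w) b)).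
  apply: measurable_dHSIC => i' j O oO.
  have := measurable_fun_coordinates (@model_data_measurable _ _ _ _ _ _ W (b j i')).
  exact.
apply: measurable_funD; last first.
  by apply: measurable_funM => //; exact: model_noise_measurable.
rewrite /extend_boot; case: (unlift ord0 i) => [l|]; last exact: resample_meas.
apply: (measurable_finite_choice
  (F := fun b w => dHSIC H (resample (fun i => model_data W i w) b))) => //.
exact: model_boot_measurable.
Qed.

(** The rejection event depends on the data through finitely many kernel values,
    for each of the finitely many values of the bootstrap maps. *)
Lemma measurable_rejection alpha : measurable [set w |
  dp_pvalue H eps delta (fun i => model_data W i w)
    (fun l => model_boot W l w) (fun i => model_noise W i w) <= alpha].
Proof.
pose p w := dp_pvalue H eps delta (fun i => model_data W i w)
  (fun l => model_boot W l w) (fun i => model_noise W i w).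
suff p_meas : measurable_fun setT p.
  have := p_meas measurableT `]-oo, alpha]%classic (measurable_itv _).
  by rewrite setTI (_ : _ @^-1` _ = [set w | p w <= alpha]).
apply: measurable_funM => //; apply: measurable_funD => //.
apply: measurable_sum => l.
under eq_fun do rewrite mulrb.
apply: measurable_fun_ifT => //.
by apply: measurable_fun_ler; exact: measurable_dp_stat.
Qed.

End test_measurability.

(** * Laplace noise and counting *)

Section laplace.
Context {R : realType}.
Local Notation mu := lebesgue_measure.
Local Notation lap A := (\int[mu]_(x in A) (@laplace_pdf R x)%:E)%E.

Lemma measurable_laplace_pdf : measurable_fun setT (@laplace_pdf R).
Proof.
apply: measurable_funM => //.
apply: (measurableT_comp (@measurable_expR R)).
exact: measurableT_comp.
Qed.

Lemma laplace_pdf_ge0 (x : R) : 0 <= laplace_pdf x.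
Proof. by rewrite divr_ge0// expR_ge0. Qed.

(** On the half-line the Laplace density is half of the exponential density. *)
Lemma laplace_nonneg : (lap (`[0%R, +oo[) = (2^-1)%:E)%E.
Proof.
have -> : (lap (`[0%R, +oo[) = \int[mu]_x ((2^-1)%:E * (exponential_pdf 1 x)%:E))%E.
  rewrite [LHS]integral_mkcond; apply: eq_integral => x _.
  rewrite patchE /exponential_pdf patchE; case: ifP => [|_].
    rewrite inE/= in_itv/= andbT => x_ge0.
    by rewrite /laplace_pdf ger0_norm// mul1r mulN1r -EFinM mulrC.
  by rewrite mule0.
rewrite ge0_integralZl//.
- by rewrite integral_exponential_pdf// mule1.
- by apply/measurable_EFinP; exact: measurable_exponential_pdf.
- by move=> x _; rewrite lee_fin exponential_pdf_ge0.
Qed.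

Lemma laplace_lower_tail_gt0 (a : R) : (0 < lap (`]-oo, a]))%E.
Proof.
(* The density is unimodal, hence at least m on [a - 1, a]. *)
pose m : R := Num.min (laplace_pdf (a - 1)) (laplace_pdf a).
have pdf_gt0 (x : R) : 0 < laplace_pdf x by rewrite divr_gt0// expR_gt0.
have m_gt0 : 0 < m by rewrite /m lt_min !pdf_gt0.
have sub : `[a - 1, a]%classic `<=` (`]-oo, a]%classic : set R).
  by move=> x; rewrite /= !in_itv/= => /andP[].
have pdf_meas (A : set R) : measurable_fun A (fun x => (@laplace_pdf R x)%:E).
  by apply/measurable_EFinP; exact: measurable_funTS measurable_laplace_pdf.
apply: (@lt_le_trans _ _ (lap (`[(a - 1)%R, a]))%E); last first.
  apply: ge0_subset_integral => //; first exact: pdf_meas.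
  by move=> x _; rewrite lee_fin laplace_pdf_ge0.
apply: (@lt_le_trans _ _ (\int[mu]_(x in `[(a - 1)%R, a]) (cst m%:E x))%E).
  rewrite integral_cst//= lebesgue_measure_itv/= lte_fin.
  by rewrite ltrBlDr ltrDl ltr01 -EFinB opprB addrC subrK mule1 lte_fin.
apply: ge0_le_integral => //.
- by move=> x /=; rewrite lee_fin ltW.
- exact: pdf_meas.
move=> x; rewrite /= in_itv/= => /andP[ax xa].
rewrite lee_fin ge_min /laplace_pdf !ler_pM2r ?invr_gt0// !ler_expR !lerN2.
have [x_ge0|x_lt0] := leP 0 x.
  by rewrite (ger0_norm x_ge0) (ger0_norm (le_trans x_ge0 xa)) xa orbT.
by rewrite (ltr0_norm x_lt0) (ltr0_norm (le_lt_trans ax x_lt0)) lerN2 ax.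
Qed.

End laplace.

Section counting_bound.
Context {R : realType} {dO : measure_display} {Omega : measurableType dO}
  (Q : probability Omega R).

(** Markov's inequality restricted to F: integrating the pointwise bound of
    M 1_F by the number of occurring events involves the probability of each A i
    alone, so that pairwise independence will suffice to evaluate it. *)
Lemma markov_count (I : finType) (F : set Omega) (A : I -> set Omega) (M : R) :
  0 <= M -> measurable F -> (forall i, measurable (A i)) ->
  (forall w, F w -> M <= \sum_i \1_(A i) w) ->
  (M%:E * Q F <= \sum_i Q (A i))%E.
Proof.
move=> M_ge0 F_meas A_meas count_ge.
have -> : (M%:E * Q F = \int[Q]_w (M * \1_F w)%:E)%E.
  under eq_integral do rewrite EFinM.
  rewrite ge0_integralZl// ?integral_indic ?setIT//.
  exact/measurable_EFinP/measurable_indic.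
have -> : (\sum_i Q (A i) = \int[Q]_w (\sum_i \1_(A i) w)%:E)%E.
  under [RHS]eq_integral do rewrite -sumEFin.
  rewrite ge0_integral_sum//.
    by apply: eq_bigr => i _; rewrite integral_indic ?setIT.
  by move=> i; exact/measurable_EFinP/measurable_indic.
apply: ge0_le_integral => //.
- by move=> w _; rewrite lee_fin mulr_ge0.
- by apply/measurable_EFinP; apply: measurable_funM => //; exact: measurable_indic.
- by apply/measurable_EFinP; apply: measurable_sum => i; exact: measurable_indic.
move=> w _; rewrite lee_fin [\1_F w]indicE; case: (boolP (w \in F)) => [|_].
  by rewrite inE mulr1; exact: count_ge.
by rewrite mulr0 sumr_ge0.
Qed.

End counting_bound.

(** * The rejection probability *)

Section rejection_bound.
Context {R : realType} {d : nat} {X : 'I_d -> ptopologicalType}.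
Variables (k : forall j, X j -> X j -> R) (K : 'I_d -> R).
Hypotheses (X_sep : forall j, separable_space (X j))
  (k_psd : forall j, psd_kernel (@k j))
  (k_diag : forall j (x : X j), k x x = K j)
  (k_cont : forall j, continuous (fun p : X j * X j => k p.1 p.2)).
Variables (H : rkhs (tensor_kernel k)) (P : probability (prod_space X) R).
Variables (n B : nat) (W : dp_bootstrap_model P n B).
Variables (eps delta alpha : R).
Local Notation Q := (model_prob W).
Local Notation zeta := (model_noise W).
Local Notation mu := lebesgue_measure.
Local Notation stat w := (dp_stat H eps delta (fun i => model_data W i w)
    (fun l => model_boot W l w) (fun i => zeta i w)).

Let noise_measurable i A : measurable A -> measurable (zeta i @^-1` A).
Proof.
by move=> mA; rewrite -[X in measurable X]setTI; exact: model_noise_measurable.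
Qed.

Lemma noise_lt0 i : Q (zeta i @^-1` `]-oo, 0[) = (2^-1)%:E.
Proof.
have Q_nonneg : Q (zeta i @^-1` `[0, +oo[) = (2^-1)%:E.
  by rewrite model_noise_law// laplace_nonneg.
have <- : ~` (zeta i @^-1` `[0, +oo[) = zeta i @^-1` `]-oo, 0[.
  by rewrite preimage_setC setCitvr.
rewrite probability_setC ?Q_nonneg; last exact: noise_measurable.
by rewrite -EFinB; congr EFin; lra.
Qed.

Lemma noise_joint i l (A C : set R) : i != l -> measurable A -> measurable C ->
  Q (zeta i @^-1` A `&` zeta l @^-1` C) =
  (Q (zeta i @^-1` A) * Q (zeta l @^-1` C))%E.
Proof.
move=> i_neq mA mC.
pose v i : 'I_n + ('I_B + 'I_B.+1) := inr (inr i).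
have v_neq : v i != v l by rewrite /v; apply: contra i_neq => /eqP[->].
pose E u := if u == v i then zeta i @^-1` A else zeta l @^-1` C.
have EF u : u \in [set v i; v l]%SET ->
    match u with
    | inl i => preimage_set_system setT (model_data W i) measurable
    | inr (inl l) => preimage_set_system setT (model_boot W l) setT
    | inr (inr i) => preimage_set_system setT (zeta i) measurable
    end (E u).
  rewrite !inE => /orP[]/eqP ->; rewrite /E.
    by rewrite eqxx; exists A => //; rewrite setTI.
  by rewrite eq_sym (negPf v_neq); exists C => //; rewrite setTI.
have := model_independent EF.
rewrite big_setU1 ?inE//= big_set1 /E eqxx eq_sym (negPf v_neq) => <-.
congr (Q _); apply/seteqP; split=> [w [Aw Cw] u /=|w EW].
  by rewrite !inE => /orP[]/eqP ->; rewrite ?eqxx ?(eq_sym (v l)) ?(negPf v_neq).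
split.
  by have := EW (v i); rewrite /= !inE eqxx; exact.
have := EW (v l); rewrite /= !inE eqxx orbT eq_sym (negPf v_neq); exact.
Qed.

(** On the event that the noise of the observed statistic is at most a, rejection
    forces at least (1 - alpha) (B + 1) of the other noises to be negative; each
    of them is negative with conditional probability 1/2, so Markov's inequality
    bounds the conditional probability of rejection by 1 / (2 (1 - alpha)). *)
Lemma rejection_probability_le a : alpha < 1 ->
  (forall w (l : 'I_B), zeta ord0 w <= a -> 0 <= zeta (lift ord0 l) w ->
     stat w ord0 <= stat w (lift ord0 l)) ->
  (rejection_probability H eps delta alpha W <=
   (1 - fine (\int[mu]_(x in `]-oo, a]) (@laplace_pdf R x)%:E)
        * (1 - (2 * (1 - alpha))^-1))%:E)%E.
Proof.
move=> alpha_lt1 stat_le; rewrite /rejection_probability.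
set Rej := [set w | _].
have Rej_meas : measurable Rej by exact: (measurable_rejection X_sep k_psd k_diag k_cont).
pose L := zeta ord0 @^-1` `]-oo, a].
have L_meas : measurable L by exact: noise_measurable.
have -> : (\int[mu]_(x in `]-oo, a]) (laplace_pdf x)%:E)%E = Q L.
  by rewrite model_noise_law.
set pi := fine (Q L).
have QL : Q L = pi%:E by rewrite fineK// fin_num_measure.
have pi_ge0 : 0 <= pi by rewrite fine_ge0.
pose A (l : 'I_B) := L `&` zeta (lift ord0 l) @^-1` `]-oo, 0[.
have A_meas l : measurable (A l).
  by apply: measurableI => //; exact: noise_measurable.
have QA l : Q (A l) = (pi * 2^-1)%:E.
  by rewrite noise_joint// -/L QL noise_lt0.
have RL_meas : measurable (Rej `&` L) by exact: measurableI.
have B1_gt0 : 0 < B.+1%:R :> R by rewrite ltr0n.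
have count_ge w : (Rej `&` L) w -> (1 - alpha) * B.+1%:R <= \sum_l \1_(A l) w :> R.
  move=> [p_le Lw].
  move: p_le; rewrite /Rej/= /dp_pvalue mulrC ler_pdivrMr// => p_le.
  have : \sum_(l < B) (1 - \1_(A l) w) <=
      \sum_(l < B) (stat w ord0 <= stat w (lift ord0 l))%R%:R :> R.
    apply: ler_sum => l _; rewrite indicE.
    have [lt0|ge0] := ltP (zeta (lift ord0 l) w) 0.
      by rewrite mem_set ?subrr//; split => //; rewrite /= in_itv.
    have zeta0_le : zeta ord0 w <= a by move: Lw; rewrite /L/= in_itv.
    by rewrite stat_le// lerBlDr lerDl; case: (_ \in _).
  rewrite sumrB sumr_const card_ord => sum_le.
  by move: p_le sum_le; rewrite -natr1; lra.
have M_gt0 : 0 < (1 - alpha) * B.+1%:R by rewrite mulr_gt0// subr_gt0.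
have := markov_count Q (ltW M_gt0) RL_meas A_meas count_ge.
under eq_bigr do rewrite QA.
rewrite sumEFin sumr_const card_ord.
set q := fine (Q (Rej `&` L)).
have Qq : Q (Rej `&` L) = q%:E by rewrite fineK// fin_num_measure.
rewrite Qq -EFinM lee_fin => q_le.
have {}q_le : q <= pi * (2 * (1 - alpha))^-1.
  have : q * (1 - alpha) * B.+1%:R <= pi / 2 * B.+1%:R.
    rewrite -mulrA mulrC; apply: le_trans q_le _.
    by rewrite -[_ *+ B]mulr_natr ler_wpM2l ?divr_ge0// ler_nat.
  rewrite ler_pM2r// -ler_pdivlMr ?subr_gt0// => /le_trans; apply.
  by rewrite invfM mulrA.
have -> : Rej = (Rej `\` L) `|` (Rej `&` L) by rewrite setUC setUIDK.
apply: le_trans (measureU2 _ _ _) _ => //; first exact: measurableD.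
apply: (@le_trans _ _ (Q (~` L) + Q (Rej `&` L))%E).
  apply: leeD => //; apply: le_measure; rewrite ?inE.
  - exact: measurableD.
  - exact: measurableC.
  - by move=> w [].
rewrite probability_setC// Qq QL -EFinB -EFinD lee_fin; lra.
Qed.

End rejection_bound.

(** * The sensitivity does not vanish *)

Section sensitivity_bound.
Context {R : realType} {e : nat} {X : 'I_e.+2 -> ptopologicalType}.
Variables (k : forall j, X j -> X j -> R) (K : 'I_e.+2 -> R).
Hypotheses (k_sym : forall j (x y : X j), k x y = k y x)
  (k_ge0 : forall j (x y : X j), 0 <= k x y)
  (k_le : forall j (x y : X j), k x y <= K j)
  (k_diag : forall j (x : X j), k x x = K j)
  (K_gt0 : forall j, 0 < K j).
Variable H : rkhs (tensor_kernel k).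
Let kappa := Num.sqrt (\prod_j K j).

Lemma tensor_dHSIC_le n (D : dataset X n) : (0 < n)%N -> dHSIC H D <= 2 * kappa.
Proof.
move=> n_gt0; apply: dHSIC_le => //.
  by apply: prodr_ge0 => j _; exact: ltW.
move=> z z'; rewrite ger0_norm; last by apply: prodr_ge0.
by apply: ler_prod => j _; rewrite k_ge0 k_le.
Qed.

(** Changing one observation in a constant dataset, then letting the bootstrap
    maps copy the changed observation to half of the positions, turns the value
    0 into that of a two-point dataset, which is bounded away from 0 in n. *)
Lemma sensitivity_ge n (x y : prod_space X) : (2 <= n)%N ->
  (forall j : 'I_e.+2, (j < 2)%N -> k (x j) (y j) <= K j / 2) ->
  2 / 9 * kappa <= sensitivity H n.
Proof.
case: n => [|[|n']]// _ xy_far.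
set N := n'.+2.
pose y' : prod_space X := fun j => if (j < 2)%N then y j else x j.
pose D (i : 'I_N) : prod_space X := x.
pose D' (i : 'I_N) : prod_space X := if i == ord0 then y' else x.
pose b : bootmap e.+2 N :=
  [ffun=> [ffun i : 'I_N => if (i < N./2)%N then ord0 else ord_max]].
have DE : resample D b = fun=> x by [].
have D'E : resample D' b = two_point_dataset (n := N) N./2 x y'.
  apply/funext => i; apply: functional_extensionality_dep => j.
  rewrite /resample /two_point_dataset !ffunE /D'.
  by case: (i < N./2)%N; rewrite ?eqxx.
have value_ge : 2 / 9 * kappa <= dHSIC H (resample D' b).
  have y'E (j : 'I_e.+2) : (2 <= j)%N -> y' j = x j.
    by move=> j_ge2; rewrite /y' ifF// ltnNge j_ge2.
  have half_le : (N./2 <= N)%N by rewrite -{2}(odd_double_half N) -addnn addnA leq_addl.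
  rewrite D'E (two_point_dHSIC (ltn0Sn _) half_le y'E H k_sym).
  set p : R := _ / _.
  have p_bnd : 1 / 3 <= p <= 2 / 3.
    have : N%:R = (odd N)%:R + 2 * N./2%:R :> R.
      by rewrite -{1}(odd_double_half N) natrD -mul2n natrM.
    have : 1 <= N./2%:R :> R by rewrite ler1n.
    have : 0 <= ((odd N)%:R : R) <= 1 by case: (odd N); rewrite ?lexx ?ler01.
    rewrite /p ler_pdivlMr ?ltr0n// ler_pdivrMr ?ltr0n// -/N.
    by move: N%:R N./2%:R (_%:R : R) => u v t; lra.
  have c_ge : 2 / 9 <= p * (1 - p) by move: p_bnd; nra.
  have dist_ge (j : 'I_e.+2) : (j < 2)%N ->
      K j <= k (y' j) (y' j) + k (x j) (x j) - 2 * k (x j) (y' j).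
    by move=> j_lt2; rewrite !k_diag /y' j_lt2; have := xy_far j j_lt2; lra.
  set rest := \prod_(j < e) _.
  have -> : 2 / 9 * kappa =
      Num.sqrt ((2 / 9) ^+ 2 * K ord0 * K (lift ord0 ord0) * rest).
    have -> : rest = \prod_(j < e) K (lift ord0 (lift ord0 j)).
      by apply: eq_bigr => j _; rewrite k_diag.
    rewrite /kappa !big_ord_recl -2!(mulrA ((2 / 9) ^+ 2)) -(mulrA (K ord0)).
    by rewrite [RHS]sqrtrM ?sqr_ge0// sqrtr_sqr ger0_norm.
  have rest_ge0 : 0 <= rest by apply: prodr_ge0.
  rewrite ler_sqrt; last first.
    have dist_ge0 j j_lt2 := le_trans (ltW (K_gt0 j)) (dist_ge j j_lt2).
    apply: mulr_ge0 => //; apply: mulr_ge0; last exact: dist_ge0.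
    by apply: mulr_ge0; [exact: sqr_ge0 | exact: dist_ge0].
  apply: ler_wpM2r => //.
  apply: ler_pM; rewrite ?mulr_ge0 ?sqr_ge0 ?(ltW (K_gt0 _)) ?dist_ge//.
  apply: ler_pM; rewrite ?sqr_ge0 ?(ltW (K_gt0 _)) ?dist_ge//.
  by rewrite ler_pXn2r// nnegrE// (le_trans _ c_ge).
apply: le_trans value_ge _.
have -> : dHSIC H (resample D' b) = `|dHSIC H (resample D b) - dHSIC H (resample D' b)|.
  by rewrite DE dHSIC_cst// sub0r normrN ger0_norm// dHSIC_ge0.
apply: ub_le_sup; last first.
  exists b, D, D'; split => // i i'; rewrite /D /D'.
  by case: eqP => [->|]//; case: eqP => [->|].
exists (4 * kappa) => _ [b' [E [E' [_ ->]]]].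
have := tensor_dHSIC_le (resample E b') isT; have := dHSIC_ge0 H (resample E b').
have := tensor_dHSIC_le (resample E' b') isT; have := dHSIC_ge0 H (resample E' b').
by rewrite ler_norml; lra.
Qed.

End sensitivity_bound.

(** * A dependent law, and inconsistency *)

Section two_point_law.
Context {R : realType} {dT : measure_display} {T : measurableType dT}.
Variables (x y : T).

Let half : {nonneg R} := (2^-1 : R)%:nng.

Definition two_point_law : set T -> \bar R :=
  measure_add (mscale half \d_x) (mscale half \d_y).

HB.instance Definition _ := Measure.on two_point_law.

Lemma two_point_lawE A : two_point_law A = ((\1_A x + \1_A y) / 2)%:E.
Proof.
have -> : two_point_law A = ((2^-1 * \1_A x)%:E + (2^-1 * \1_A y)%:E)%E.
  exact: measure_addE.
by rewrite -EFinD -mulrDr mulrC.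
Qed.

Lemma two_point_law_setT : two_point_law setT = 1%E.
Proof. by rewrite two_point_lawE !indicE !in_setT/=; congr EFin; rewrite mulr1n; lra. Qed.

HB.instance Definition _ :=
  Measure_isProbability.Build _ _ _ two_point_law two_point_law_setT.

End two_point_law.

(** The separating rectangle has probability 1/2, whereas its first two sides
    have marginal probability 1/2 each. *)
Lemma two_point_law_dependent (R : realType) (e : nat)
    (X : 'I_e.+2 -> ptopologicalType) (A : forall j, set (X j))
    (x y : prod_space X) :
  (forall j, borel (A j)) -> (forall j : 'I_e.+2, (2 <= j)%N -> A j = setT) ->
  (forall j : 'I_e.+2, (j < 2)%N -> A j (x j) /\ ~ A j (y j)) ->
  ~ is_product_of_marginals (two_point_law (R := R) x y).
Proof.
move=> A_borel A_T A_sep /(_ A A_borel).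
have [Ax0 Ay0] := A_sep ord0 isT.
have [Ax1 Ay1] := A_sep (lift ord0 ord0) isT.
have margE j : marginal (two_point_law (R := R) x y) (A j) =
    ((\1_(A j) (x j) + \1_(A j) (y j)) / 2)%:E.
  by rewrite /marginal [LHS]two_point_lawE !indicE.
have xA j : A j (x j).
  by case: (ltnP j 2) => [/A_sep[]|/A_T ->].
have x_rect : rectangle A x by [].
have y_rect : ~ rectangle A y by move/(_ ord0).
rewrite [X in X = _ -> _]two_point_lawE !indicE (mem_set x_rect) (memNset y_rect).
under eq_bigr do rewrite margE.
rewrite prodEFin !big_ord_recl !indicE.
rewrite (mem_set Ax0) (mem_set Ax1) (memNset Ay0) (memNset Ay1).
rewrite big1 => [[]|j _]; first by lra.
by rewrite !indicE A_T// !in_setT mulr1n; lra.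
Qed.

Lemma limn_esup_le_eventually (R : realType) (u : nat -> \bar R) (c : \bar R) N :
  (forall n, (N <= n)%N -> (u n <= c)%E) -> (limn_esup u <= c)%E.
Proof.
move=> u_le; rewrite limn_esup_lim (cvg_lim _ (@cvg_esups_inf _ u))//.
apply: (@le_trans _ _ (esups u N)); first by apply: ereal_inf_lbound; exists N.
by apply: ge_ereal_sup => _ [n /= Nn <-]; exact: u_le.
Qed.

Lemma dp_xi_gt0 (R : realType) (eps delta : R) :
  0 < eps -> 0 <= delta < 1 -> 0 < dp_xi eps delta.
Proof.
move=> eps_gt0 /andP[delta_ge0 delta_lt1]; rewrite /dp_xi ltr_wpDr// ln_ge0//.
by rewrite div1r invf_ge1 ?subr_gt0// gerBl.
Qed.

Section inconsistency.
Context {R : realType} {e : nat} {X : 'I_e.+2 -> ptopologicalType}.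
Variables (k : forall j, X j -> X j -> R) (K : 'I_e.+2 -> R).
Hypotheses (X_sep : forall j, separable_space (X j))
  (k_psd : forall j, psd_kernel (@k j))
  (k_cont : forall j, continuous (fun p : X j * X j => k p.1 p.2))
  (k_ge0 : forall j (x y : X j), 0 <= k x y)
  (k_le : forall j (x y : X j), k x y <= K j)
  (k_diag : forall j (x : X j), k x x = K j)
  (K_gt0 : forall j, 0 < K j).
Variables (x y : prod_space X).
Hypothesis xy_far : forall j, k (x j) (y j) <= K j / 2.

(** The constant 9/2 makes the noise gap, in units of the scale 2 Delta / xi,
    at least 9 Delta, which exceeds 2 kappa, the largest value of dHSIC. *)
Lemma noise_hides_observed_stat (H : rkhs (tensor_kernel k)) eps delta n B
    (D : dataset X n) (b : 'I_B -> bootmap e.+2 n) (zeta : 'I_B.+1 -> R) l :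
  (2 <= n)%N -> 0 < dp_xi eps delta ->
  zeta ord0 <= - (9 / 2 * dp_xi eps delta) -> 0 <= zeta (lift ord0 l) ->
  dp_stat H eps delta D b zeta ord0 <= dp_stat H eps delta D b zeta (lift ord0 l).
Proof.
move=> n_ge2; rewrite /dp_stat; set xi := dp_xi eps delta => xi_gt0 zeta0_le zetal_ge0.
have k_sym j (t u : X j) : k t u = k u t by exact: (k_psd j).1.
have := sensitivity_ge k_sym k_ge0 k_le k_diag K_gt0 H n_ge2 (fun j _ => xy_far j).
have := tensor_dHSIC_le k_ge0 k_le K_gt0 H (resample D (extend_boot b ord0)) (ltnW n_ge2).
have := dHSIC_ge0 H (resample D (extend_boot b (lift ord0 l))).
set T0 := dHSIC _ _; set Tl := dHSIC _ _; set kappa := Num.sqrt _.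
set Delta := sensitivity _ _ => Tl_ge0 T0_le Delta_ge.
have kappa_ge0 : 0 <= kappa by exact: sqrtr_ge0.
have Delta_ge0 : 0 <= Delta by apply: le_trans Delta_ge; rewrite mulr_ge0.
have s_ge0 : 0 <= 2 * Delta * xi^-1 by rewrite !mulr_ge0// invr_ge0 ltW.
have : 2 * Delta * xi^-1 * zeta ord0 <= - (9 * Delta).
  apply: le_trans (ler_wpM2l s_ge0 zeta0_le) _.
  by rewrite (_ : _ * _ = - (9 * Delta)) => [//|]; field; rewrite gt_eqF.
have := mulr_ge0 s_ge0 zetal_ge0.
by move: Tl_ge0 T0_le Delta_ge; lra.
Qed.

(** The bound of [rejection_probability_le] is the same for all n >= 2. *)
Lemma inconsistent_power_any (H : rkhs (tensor_kernel k)) eps delta alpha B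
    (P : probability (prod_space X) R) :
  0 < dp_xi eps delta -> alpha < 1 / 2 ->
  inconsistent_power H eps delta alpha B P.
Proof.
move=> xi_gt0 alpha_lt W.
set a := - (9 / 2 * dp_xi eps delta).
set tail : \bar R := (\int[lebesgue_measure]_(t in `]-oo, a]) (laplace_pdf t)%:E)%E.
have tail_gt0 : 0 < fine tail.
  apply: fine_gt0; rewrite laplace_lower_tail_gt0/=.
  have <- : model_prob (W 0%N) (model_noise (W 0%N) ord0 @^-1` `]-oo, a]) = tail.
    by rewrite model_noise_law.
  by rewrite ltey_eq fin_num_measure// -[X in measurable X]setTI;
     exact: model_noise_measurable.
have c_gt0 : 0 < 1 - (2 * (1 - alpha))^-1.
  by rewrite subr_gt0 invf_lt1; lra.
apply: (@le_lt_trans _ _ (1 - fine tail * (1 - (2 * (1 - alpha))^-1))%:E).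
  apply: (@limn_esup_le_eventually _ _ _ 2) => n n_ge2.
  apply: (rejection_probability_le X_sep k_psd k_diag k_cont); first lra.
  by move=> w l; exact: noise_hides_observed_stat.
by rewrite lte_fin gtrBl mulr_gt0.
Qed.

(** In each of the first two coordinates x and y are separated by the Borel set
    where the continuous section of the kernel at x exceeds 3/4 of its maximum. *)
Lemma exists_dependent_law :
  exists P : probability (prod_space X) R, ~ is_product_of_marginals P.
Proof.
pose A (j : 'I_e.+2) : set (X j) :=
  if (j < 2)%N then k (x j) @^-1` `]3 / 4 * K j, +oo[%classic else setT.
exists (two_point_law x y); apply: (two_point_law_dependent (A := A)).
- move=> j; apply: sub_sigma_algebra; rewrite /A; case: ifP => _; last exact: openT.
  apply: open_comp => // z _.
  exact: (kernel_section_continuous (@k_cont j)).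
- by move=> j j_ge2; rewrite /A ltnNge j_ge2.
move=> j j_lt2; rewrite /A j_lt2/= !in_itv/= !andbT k_diag.
by have := xy_far j; have := K_gt0 j; split; [|apply/negP; rewrite -leNgt]; lra.
Qed.

End inconsistency.

Theorem proposition3p3 (R : realType) (eps delta : R)
    (heps : 0 < eps) (hdelta : 0 <= delta < 1) :
  exists2 C : R, 0 < C &
  forall (d : nat) (X : 'I_d -> ptopologicalType) (V : 'I_d -> zmodType)
    (iota : forall j, X j -> V j) (kappa : forall j, V j -> R)
    (k : forall j, X j -> X j -> R) (H : rkhs (tensor_kernel k))
    (alpha : R) (B : nat -> nat),
    (2 <= d)%N ->
    (forall j, separable_space (X j)) ->
    (forall j, injective (iota j)) ->
    (forall j, psd_kernel (k j)) ->
    (forall j, continuous (fun p : X j * X j => k j p.1 p.2)) ->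
    (forall j x x', 0 <= k j x x' <= kappa j 0) ->
    (forall j, translation_invariant (iota j) (kappa j) (k j)) ->
    (forall j, 0 < kappa j 0) ->
    (forall j, nonempty_level_sets (k j) (kappa j 0)) ->
    characteristic (tensor_kernel k) ->
    0 < alpha < 1 ->
    (forall n, (1 <= n)%N -> alpha^-1 - 1 < (B n)%:R) ->
    alpha < 1 / 2 ->
    (exists2 P : probability (prod_space X) R,
       ~ is_product_of_marginals P &
       inconsistent_power H eps delta alpha B P) /\
    (alpha < C ->
     forall P : probability (prod_space X) R,
       ~ is_product_of_marginals P ->
       inconsistent_power H eps delta alpha B P).
Proof.
(* All alternatives are handled as soon as alpha < 1/2, so that any positive
   constant is a witness. *)
exists 1 => // d X V iota kappa k H alpha B d_ge2.
case: d d_ge2 X V iota kappa k H => [|[|e]]// _ X V iota kappa k H.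
move=> X_sep _ k_psd k_cont k_bnd k_inv K_gt0 k_level _ _ _ alpha_lt.
pose K j := kappa j 0.
have k_ge0 j x y : 0 <= k j x y by case/andP: (k_bnd j x y).
have k_le j x y : k j x y <= K j by case/andP: (k_bnd j x y).
have k_diag j x : k j x x = K j by rewrite (k_inv j).2 subrr.
have /cid[xy xy_far] : exists xy : forall j, X j * X j,
    forall j, k j (xy j).1 (xy j).2 <= K j / 2.
  have level j : {xy : X j * X j | k j xy.1 xy.2 <= K j / 2}.
    apply: cid; have [|x [y xy_le]] := k_level j (K j / 2); last by exists (x, y).
    by have := K_gt0 j; rewrite /K; lra.
  by exists (fun j => sval (level j)) => j; exact: (svalP (level j)).
pose x : prod_space X := fun j => (xy j).1.
pose y : prod_space X := fun j => (xy j).2.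
have inconsistent P : inconsistent_power H eps delta alpha B P.
  apply: (inconsistent_power_any X_sep k_psd k_cont k_ge0 k_le k_diag K_gt0
    (x := x) (y := y)) => //.
  exact: dp_xi_gt0.
split=> //.
have [P P_dep] := exists_dependent_law k_cont k_diag K_gt0 (x := x) (y := y) xy_far.
by exists P.
Qed.
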